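(* Let $\mathbf{C}$ be a pointed category with finite limits and cokernels, suppose that $\mathbf{C}$ has coequalizers of kernel pairs, and let $\mathbf{E}$ be the class of all regular epimorphisms in $\mathbf{C}$. Then the following conditions are equivalent: (i) $(\mathbf{C},\mathbf{E})$ is a relative weakly homological category; (ii) $(\mathbf{C},\mathbf{E})$ is a relative homological category; (iii) $\mathbf{C}$ is a homological category in the sense of Borceux and Bourn.
   Context: A category is pointed if it has a zero object. Let $\mathbf{C}$ be a pointed category with finite limits and cokernels, and $\mathbf{E}$ a class of morphisms in $\mathbf{C}$ containing all isomorphisms. The pair $(\mathbf{C},\mathbf{E})$ is called a relative homological category if it satisfies (a)-(g) below, and a relative weakly homological category if it satisfies (a)-(e): (a) the class $\mathbf{E}$ is pullback stable (every pullback of a morphism in $\mathbf{E}$ along an arbitrary morphism is in $\mathbf{E}$); (b) every morphism in $\mathbf{E}$ is a normal epimorphism, i.e. a cokernel of some morphism; (c) the $\mathbf{E}$-short-five lemma holds: whenever $f:A\to B$ and $f':A'\to B$ are in $\mathbf{E}$, $k:K\to A$ is a kernel of $f$, $k':K\to A'$ is a kernel of $f'$, and $w:A\to A'$ satisfies $wk=k'$ and $f'w=f$, the morphism $w$ is an isomorphism; (d) the class $\mathbf{E}$ is closed under composition; (e) if $f\in\mathbf{E}$ and $gf\in\mathbf{E}$, then $g\in\mathbf{E}$; (f) if a morphism $f$ in $\mathbf{C}$ factors as $f=em$ with $e\in\mathbf{E}$ and $m$ a monomorphism, then there exist a monomorphism $m'$ in $\mathbf{C}$ and a morphism $e'$ in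 $\mathbf{E}$ such that $f=m'e'$; (g) whenever $f:A\to B$ and $f':A'\to B$ are in $\mathbf{E}$, $k:K\to A$ is a kernel of $f$, $k':K'\to A'$ is a kernel of $f'$, and $u:K\to K'$, $w:A\to A'$ are morphisms with $wk=k'u$ and $f'w=f$ and $u\in\mathbf{E}$, the morphism $w$ is in $\mathbf{E}$. A category is homological (Borceux-Bourn) if it is pointed, regular, and protomodular. Here a category with finite limits is protomodular (Bourn) if for every morphism $v:B'\to B$ the pullback functor $v^*:\mathrm{Pt}(B)\to\mathrm{Pt}(B')$ reflects isomorphisms, where $\mathrm{Pt}(B)$ is the category whose objects are triples $(A,p,s)$ with $p:A\to B$, $s:B\to A$, $ps=1_B$, and whose morphisms $(A,p,s)\to(A',p',s')$ are morphisms $w:A\to A'$ with $p'w=p$ and $ws=s'$. A category is regular if it has finite limits and coequalizers of kernel pairs, and regular epimorphisms (coequalizers of some parallel pair) are pullback stable. *)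

(* Defs.v *)
From Stdlib Require Import List ProofIrrelevance ClassicalEpsilon.

Declare Scope cat_scope.
Delimit Scope cat_scope with cat.
Open Scope cat_scope.

Record Category : Type := {
  Obj :> Type;
  Hom : Obj -> Obj -> Type;
  idm : forall A, Hom A A;
  comp : forall {A B D}, Hom B D -> Hom A B -> Hom A D;
  comp_idl : forall A B (f : Hom A B), comp (idm B) f = f;
  comp_idr : forall A B (f : Hom A B), comp f (idm A) = f;
  comp_assoc : forall A B D E (h : Hom D E) (g : Hom B D) (f : Hom A B),
    comp h (comp g f) = comp (comp h g) f
}.

Arguments Hom {c} A B.
Arguments idm {c} A.
Arguments comp {c A B D} g f.
Arguments comp_idl {c A B} f.
Arguments comp_idr {c A B} f.
Arguments comp_assoc {c A B D E} h g f.

Notation "g ∘ f" := (comp g f) (at level 40, left associativity) : cat_scope.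

Record Functor (C D : Category) : Type := {
  fobj :> C -> D;
  fmap : forall {A B : C}, Hom A B -> Hom (fobj A) (fobj B);
  fmap_id : forall A : C, fmap (idm A) = idm (fobj A);
  fmap_comp : forall (A B E : C) (g : Hom B E) (f : Hom A B),
    fmap (g ∘ f) = fmap g ∘ fmap f
}.

Arguments fobj {C D} _ _.
Arguments fmap {C D} _ {A B} _.
Arguments fmap_id {C D} _ _.
Arguments fmap_comp {C D} _ {A B E} _ _.

Definition is_iso {C : Category} {A B : C} (f : Hom A B) : Prop :=
  exists g : Hom B A, g ∘ f = idm A /\ f ∘ g = idm B.

Definition is_mono {C : Category} {A B : C} (f : Hom A B) : Prop :=
  forall (X : C) (a b : Hom X A), f ∘ a = f ∘ b -> a = b.

Definition reflects_isos {C D : Category} (F : Functor C D) : Prop :=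
  forall (A B : C) (f : Hom A B), is_iso (fmap F f) -> is_iso f.

Definition finite_type (T : Type) : Prop :=
  exists l : list T, forall x : T, In x l.

Definition finite_category (J : Category) : Prop :=
  finite_type J /\ forall i j : J, finite_type (Hom i j).

Record Cone {J C : Category} (D : Functor J C) : Type := {
  apex : C;
  leg : forall j : J, Hom apex (D j);
  leg_natural : forall (i j : J) (u : Hom i j), fmap D u ∘ leg i = leg j
}.

Arguments apex {J C D} c.
Arguments leg {J C D} c j.
Arguments leg_natural {J C D} c {i j} u.

Definition is_limit {J C : Category} {D : Functor J C} (L : Cone D) : Prop :=
  forall K : Cone D,
    exists! h : Hom (apex K) (apex L), forall j : J, leg L j ∘ h = leg K j.

Definition has_finite_limits (C : Category) : Prop :=
  forall J : Category, finite_category J ->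
  forall D : Functor J C, exists L : Cone D, is_limit L.

Definition is_pullback {C : Category} {P A B D : C}
    (f : Hom A D) (g : Hom B D) (p1 : Hom P A) (p2 : Hom P B) : Prop :=
  f ∘ p1 = g ∘ p2 /\
  forall (X : C) (a : Hom X A) (b : Hom X B), f ∘ a = g ∘ b ->
    exists! h : Hom X P, p1 ∘ h = a /\ p2 ∘ h = b.

Definition is_coequalizer {C : Category} {X A Q : C}
    (a b : Hom X A) (q : Hom A Q) : Prop :=
  q ∘ a = q ∘ b /\
  forall (Y : C) (t : Hom A Y), t ∘ a = t ∘ b ->
    exists! h : Hom Q Y, h ∘ q = t.

Definition is_kernel_pair {C : Category} {R A B : C}
    (f : Hom A B) (r1 r2 : Hom R A) : Prop :=
  is_pullback f f r1 r2.

Definition has_coequalizers_of_kernel_pairs (C : Category) : Prop :=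
  forall (R A B : C) (f : Hom A B) (r1 r2 : Hom R A),
    is_kernel_pair f r1 r2 ->
    exists (Q : C) (q : Hom A Q), is_coequalizer r1 r2 q.

Definition is_initial {C : Category} (Z : C) : Prop :=
  forall X : C, exists! f : Hom Z X, True.

Definition is_terminal {C : Category} (Z : C) : Prop :=
  forall X : C, exists! f : Hom X Z, True.

Definition is_zero_object {C : Category} (Z : C) : Prop :=
  is_initial Z /\ is_terminal Z.

Definition pointed (C : Category) : Prop :=
  exists Z : C, is_zero_object Z.

Definition is_zero_morphism {C : Category} {A B : C} (f : Hom A B) : Prop :=
  exists (Z : C) (a : Hom A Z) (b : Hom Z B), is_zero_object Z /\ f = b ∘ a.

Definition is_kernel {C : Category} {K A B : C}
    (f : Hom A B) (k : Hom K A) : Prop :=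
  is_zero_morphism (f ∘ k) /\
  forall (X : C) (t : Hom X A), is_zero_morphism (f ∘ t) ->
    exists! h : Hom X K, k ∘ h = t.

Definition is_cokernel {C : Category} {A B Q : C}
    (f : Hom A B) (q : Hom B Q) : Prop :=
  is_zero_morphism (q ∘ f) /\
  forall (Y : C) (t : Hom B Y), is_zero_morphism (t ∘ f) ->
    exists! h : Hom Q Y, h ∘ q = t.

Definition has_cokernels (C : Category) : Prop :=
  forall (A B : C) (f : Hom A B),
    exists (Q : C) (q : Hom B Q), is_cokernel f q.

Definition morphism_class (C : Category) : Type :=
  forall A B : C, Hom A B -> Prop.

Definition normal_epi {C : Category} : morphism_class C :=
  fun A B f => exists (X : C) (g : Hom X A), is_cokernel g f.

Definition regular_epi (C : Category) : morphism_class C :=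
  fun A B f => exists (X : C) (a b : Hom X A), is_coequalizer a b f.

Definition pullback_stable {C : Category} (E : morphism_class C) : Prop :=
  forall (P A B D : C) (f : Hom A D) (g : Hom B D)
         (p1 : Hom P A) (p2 : Hom P B),
    is_pullback f g p1 p2 -> E A D f -> E P B p2.

Definition short_five {C : Category} (E : morphism_class C) : Prop :=
  forall (K A A' B : C) (f : Hom A B) (f' : Hom A' B)
         (k : Hom K A) (k' : Hom K A') (w : Hom A A'),
    E A B f -> E A' B f' -> is_kernel f k -> is_kernel f' k' ->
    w ∘ k = k' -> f' ∘ w = f -> is_iso w.

(** The first four fields are the standing assumptions on the pair. *)
Record relative_weakly_homological (C : Category) (E : morphism_class C)
    : Prop := {
  rwh_pointed : pointed C;
  rwh_finite_limits : has_finite_limits C;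
  rwh_cokernels : has_cokernels C;
  rwh_isos : forall (A B : C) (f : Hom A B), is_iso f -> E A B f;
  rwh_pullback_stable : pullback_stable E;
  rwh_normal_epi : forall (A B : C) (f : Hom A B), E A B f -> normal_epi A B f;
  rwh_short_five : short_five E;
  rwh_comp : forall (A B D : C) (g : Hom B D) (f : Hom A B),
    E A B f -> E B D g -> E A D (g ∘ f);
  rwh_cancel : forall (A B D : C) (g : Hom B D) (f : Hom A B),
    E A B f -> E A D (g ∘ f) -> E B D g
}.

Record relative_homological (C : Category) (E : morphism_class C) : Prop := {
  rh_weakly : relative_weakly_homological C E;
  rh_factorization : forall (A I B : C) (f : Hom A B)
                            (m : Hom A I) (e : Hom I B),
    is_mono m -> E I B e -> f = e ∘ m ->
    exists (I' : C) (e' : Hom A I') (m' : Hom I' B),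
      E A I' e' /\ is_mono m' /\ f = m' ∘ e';
  rh_kernel_in_class : forall (K K' A A' B : C)
      (f : Hom A B) (f' : Hom A' B) (k : Hom K A) (k' : Hom K' A')
      (u : Hom K K') (w : Hom A A'),
    E A B f -> E A' B f' -> is_kernel f k -> is_kernel f' k' ->
    w ∘ k = k' ∘ u -> f' ∘ w = f -> E K K' u -> E A A' w
}.

Record point {C : Category} (B : C) : Type := {
  pt_obj : C;
  pt_proj : Hom pt_obj B;
  pt_sect : Hom B pt_obj;
  pt_split : pt_proj ∘ pt_sect = idm B
}.

Arguments pt_obj {C B} p.
Arguments pt_proj {C B} p.
Arguments pt_sect {C B} p.
Arguments pt_split {C B} p.

Record point_hom {C : Category} {B : C} (X Y : point B) : Type := {
  pt_map : Hom (pt_obj X) (pt_obj Y);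
  pt_map_proj : pt_proj Y ∘ pt_map = pt_proj X;
  pt_map_sect : pt_map ∘ pt_sect X = pt_sect Y
}.

Arguments pt_map {C B X Y} p.
Arguments pt_map_proj {C B X Y} p.
Arguments pt_map_sect {C B X Y} p.

Lemma point_hom_eq {C : Category} {B : C} {X Y : point B} (f g : point_hom X Y) :
  pt_map f = pt_map g -> f = g.
Proof.
destruct f as [f f1 f2], g as [g g1 g2]; simpl; intros <-.
now rewrite (proof_irrelevance _ f1 g1), (proof_irrelevance _ f2 g2).
Qed.

Definition point_id {C : Category} {B : C} (X : point B) : point_hom X X :=
  {| pt_map := idm (pt_obj X);
     pt_map_proj := comp_idr (pt_proj X);
     pt_map_sect := comp_idl (pt_sect X) |}.

Definition point_comp {C : Category} {B : C} {X Y Z : point B}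
    (g : point_hom Y Z) (f : point_hom X Y) : point_hom X Z.
Proof.
refine {| pt_map := pt_map g ∘ pt_map f |}.
- abstract (now rewrite comp_assoc, !pt_map_proj).
- abstract (now rewrite <- comp_assoc, !pt_map_sect).
Defined.

Definition Pt {C : Category} (B : C) : Category.
Proof.
refine {| Obj := point B; Hom := @point_hom C B; idm := @point_id C B;
          comp := @point_comp C B |}.
- abstract (intros; apply point_hom_eq, comp_idl).
- abstract (intros; apply point_hom_eq, comp_idr).
- abstract (intros; apply point_hom_eq, comp_assoc).
Defined.

Record pullback {C : Category} {A B D : C} (f : Hom A D) (g : Hom B D) : Type := {
  pb_obj : C;
  pb_fst : Hom pb_obj A;
  pb_snd : Hom pb_obj B;
  pb_spec : is_pullback f g pb_fst pb_snd
}.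

Arguments pb_obj {C A B D f g} p.
Arguments pb_fst {C A B D f g} p.
Arguments pb_snd {C A B D f g} p.
Arguments pb_spec {C A B D f g} p.

Definition pullback_choice (C : Category) : Type :=
  forall (A B D : C) (f : Hom A D) (g : Hom B D), pullback f g.

Definition pb_lift {C : Category} {A B D : C} {f : Hom A D} {g : Hom B D}
    (P : pullback f g) {X : C} (a : Hom X A) (b : Hom X B)
    (e : f ∘ a = g ∘ b) : Hom X (pb_obj P) :=
  proj1_sig (constructive_definite_description _ (proj2 (pb_spec P) X a b e)).

Lemma pb_lift_fst {C : Category} {A B D : C} {f : Hom A D} {g : Hom B D}
    (P : pullback f g) {X : C} (a : Hom X A) (b : Hom X B) (e : f ∘ a = g ∘ b) :
  pb_fst P ∘ pb_lift P a b e = a.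
Proof.
exact (proj1 (proj2_sig
  (constructive_definite_description _ (proj2 (pb_spec P) X a b e)))).
Qed.

Lemma pb_lift_snd {C : Category} {A B D : C} {f : Hom A D} {g : Hom B D}
    (P : pullback f g) {X : C} (a : Hom X A) (b : Hom X B) (e : f ∘ a = g ∘ b) :
  pb_snd P ∘ pb_lift P a b e = b.
Proof.
exact (proj2 (proj2_sig
  (constructive_definite_description _ (proj2 (pb_spec P) X a b e)))).
Qed.

Lemma pb_hom_eq {C : Category} {A B D : C} {f : Hom A D} {g : Hom B D}
    (P : pullback f g) {X : C} (h h' : Hom X (pb_obj P)) :
  pb_fst P ∘ h = pb_fst P ∘ h' -> pb_snd P ∘ h = pb_snd P ∘ h' -> h = h'.
Proof.
intros e1 e2; destruct (pb_spec P) as [sq univ].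
destruct (univ X (pb_fst P ∘ h') (pb_snd P ∘ h')) as [k [_ uniq]].
- now rewrite !comp_assoc, sq.
- now rewrite <- (uniq h), <- (uniq h').
Qed.

Lemma pullback_point_square {C : Category} {B B' : C} (v : Hom B' B) (X : point B) :
  pt_proj X ∘ (pt_sect X ∘ v) = v ∘ idm B'.
Proof. now rewrite comp_assoc, pt_split, comp_idl, comp_idr. Qed.

Definition pullback_point {C : Category} (P : pullback_choice C) {B B' : C}
    (v : Hom B' B) (X : point B) : point B' :=
  let Q := P _ _ _ (pt_proj X) v in
  {| pt_obj := pb_obj Q;
     pt_proj := pb_snd Q;
     pt_sect := pb_lift Q (pt_sect X ∘ v) (idm B') (pullback_point_square v X);
     pt_split := pb_lift_snd Q _ _ _ |}.

Lemma pullback_point_map_square {C : Category} (P : pullback_choice C) {B B' : C}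
    (v : Hom B' B) {X Y : point B} (w : point_hom X Y) :
  let Q := P _ _ _ (pt_proj X) v in
  pt_proj Y ∘ (pt_map w ∘ pb_fst Q) = v ∘ pb_snd Q.
Proof.
intros Q; rewrite comp_assoc, pt_map_proj; exact (proj1 (pb_spec Q)).
Qed.

Definition pullback_point_map {C : Category} (P : pullback_choice C) {B B' : C}
    (v : Hom B' B) {X Y : point B} (w : point_hom X Y) :
  point_hom (pullback_point P v X) (pullback_point P v Y).
Proof.
refine {| pt_map := pb_lift (P _ _ _ (pt_proj Y) v)
                      (pt_map w ∘ pb_fst (P _ _ _ (pt_proj X) v))
                      (pb_snd (P _ _ _ (pt_proj X) v))
                      (pullback_point_map_square P v w)
            : Hom (pt_obj (pullback_point P v X)) (pt_obj (pullback_point P v Y)) |}.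
- abstract (apply pb_lift_snd).
- abstract (apply pb_hom_eq; simpl; rewrite comp_assoc;
    [ now rewrite !pb_lift_fst, <- comp_assoc, pb_lift_fst, comp_assoc, pt_map_sect
    | now rewrite !pb_lift_snd ]).
Defined.

Definition pullback_functor {C : Category} (P : pullback_choice C) {B B' : C}
    (v : Hom B' B) : Functor (Pt B) (Pt B').
Proof.
refine {| fobj := (pullback_point P v : Pt B -> Pt B');
          fmap := fun X Y w => pullback_point_map P v w |}.
- abstract (intros X; apply point_hom_eq, pb_hom_eq; simpl;
    [ now rewrite pb_lift_fst, comp_idl, comp_idr
    | now rewrite pb_lift_snd, comp_idr ]).
- abstract (intros X Y Z g f; apply point_hom_eq, pb_hom_eq; simpl;
    rewrite comp_assoc;
    [ now rewrite !pb_lift_fst, <- !comp_assoc, pb_lift_fst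
    | now rewrite !pb_lift_snd ]).
Defined.

(** Different choices of pullbacks give isomorphic functors [v^*]; that choices
    exist when [C] has finite limits is [finite_limits_pullback_choice] below. *)
Definition protomodular (C : Category) : Prop :=
  has_finite_limits C /\
  forall (P : pullback_choice C) (B B' : C) (v : Hom B' B),
    reflects_isos (pullback_functor P v).

Definition regular (C : Category) : Prop :=
  has_finite_limits C /\
  has_coequalizers_of_kernel_pairs C /\
  pullback_stable (regular_epi C).

Definition homological (C : Category) : Prop :=
  pointed C /\ regular C /\ protomodular C.

Inductive cospan_obj : Set := cs_left | cs_right | cs_base.

Definition cospan_hom (i j : cospan_obj) : Set :=
  match i, j with
  | cs_left, cs_left | cs_right, cs_right | cs_base, cs_base
  | cs_left, cs_base | cs_right, cs_base => unit
  | _, _ => Empty_set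
  end.

Definition cospan : Category.
Proof.
unshelve refine {| Obj := cospan_obj; Hom := cospan_hom |}.
- intros []; exact tt.
- intros [] [] []; simpl; intros u v; first [ exact tt | now destruct u | now destruct v ].
- abstract (now intros [] [] []).
- abstract (now intros [] [] []).
- abstract (intros [] [] [] []; simpl; intros h g f;
    solve [ reflexivity | destruct h | destruct g | destruct f ]).
Defined.

Lemma cospan_finite : finite_category cospan.
Proof.
split.
- exists (cs_left :: cs_right :: cs_base :: nil); intros []; simpl; tauto.
- assert (H1 : finite_type unit) by (exists (tt :: nil); intros []; now left).
  assert (H0 : finite_type Empty_set) by (exists nil; intros []).
  intros [] []; first [ exact H0 | exact H1 ].
Qed.

Definition cospan_functor {C : Category} {A B D : C} (f : Hom A D) (g : Hom B D) :
  Functor cospan C.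
Proof.
unshelve refine {| fobj := fun i : cospan =>
  match i with cs_left => A | cs_right => B | cs_base => D end |}.
- intros [] [] u; first [ destruct u; fail | exact f | exact g | exact (idm _) ].
- abstract (now intros []).
- abstract (intros [] [] []; simpl; intros u v;
    solve [ destruct u | destruct v | now rewrite ?comp_idl, ?comp_idr ]).
Defined.

Definition cospan_cone {C : Category} {X A B D : C} {f : Hom A D} {g : Hom B D}
    (a : Hom X A) (b : Hom X B) (e : f ∘ a = g ∘ b) : Cone (cospan_functor f g).
Proof.
unshelve refine {| apex := X |}.
- intros []; [ exact a | exact b | exact (f ∘ a) ].
- abstract (intros [] []; simpl; intros u;
    solve [ destruct u | now rewrite ?comp_idl | now symmetry ]).
Defined.

Lemma finite_limits_pullback_choice (C : Category) :
  has_finite_limits C -> inhabited (pullback_choice C).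
Proof.
intros HL; constructor; intros A B D f g.
destruct (constructive_indefinite_description _
            (HL cospan cospan_finite (cospan_functor f g))) as [L lim].
refine (Build_pullback C A B D f g (apex L) (leg L cs_left) (leg L cs_right) _).
assert (ef : f ∘ leg L cs_left = leg L cs_base)
  by exact (leg_natural L (i := cs_left) (j := cs_base) tt).
assert (eg : g ∘ leg L cs_right = leg L cs_base)
  by exact (leg_natural L (i := cs_right) (j := cs_base) tt).
split; [ now rewrite ef, eg | ].
intros X a b e; destruct (lim (cospan_cone a b e)) as [h [eh uniq]].
exists h; split; [ exact (conj (eh cs_left) (eh cs_right)) | ].
intros h' [e1 e2]; apply uniq; intros []; simpl; trivial.
now rewrite <- ef, <- comp_assoc, e1.
Qed.

(* Main.v *)
Require Import Defs.

(** The three conditions are linked by two ideas, one for each direction of the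
    passage between relative and absolute notions.

    From relative to absolute.  A split epimorphism is regular, so the short
    five lemma applies to every morphism of points.  If [v^*] sends a morphism
    of points [w] to an isomorphism, then [w] carries kernels to kernels,
    because a morphism killed by the projection of a point lifts to the
    pullback along any [v] whatsoever; hence [w] is an isomorphism
    ([short_five_protomodular]).  Regularity is immediate.

    From absolute to relative.  In a regular category regular epimorphisms
    coincide with extremal ones ([regular_epi_iff_extremal]), and extremal
    epimorphisms visibly compose and cancel.  In a pointed protomodular
    category a morphism of points that carries a kernel to a kernel is an
    isomorphism ([point_hom_iso_of_kernel]).  The projection [R -> A] of the
    kernel pair of [f : A -> B], split by the diagonal, has the same kernel as
    [f], and this turns statements about regular epimorphisms into statements
    about points:
    - a regular epimorphism is the cokernel of its kernel, because the
      equalizer of [t r1] and [t r2] contains both the diagonal and the kernel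
      of [r1] as soon as [t] kills the kernel of [f] ([regular_epi_normal]);
    - in the situation of the short five lemma, the pullback of [w] along [f]
      is a morphism of points preserving the kernel, hence an isomorphism, and
      this descends to [w] because [f] is a regular epimorphism
      ([homological_short_five]).

    The remaining axiom on kernels follows from the short five lemma applied to
    any subobject through which the given morphism factors
    ([homological_kernel_in_class]), and the factorization axiom holds because
    every morphism of a regular category has an image. *)

(** * Zero morphisms, kernels and isomorphisms *)

Lemma zero_morphism_exists {C : Category} (hp : pointed C) (A B : C) :
  exists f : Hom A B, is_zero_morphism f.
Proof.
destruct hp as [Z [hi ht]].
destruct (ht A) as [a _], (hi B) as [b _].
exists (b ∘ a), Z, a, b; split; [ split | ]; trivial.
Qed.

Lemma initial_hom_eq {C : Category} {Z X : C} (h : is_initial Z) (a b : Hom Z X) :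
  a = b.
Proof. destruct (h X) as [c [_ u]]; now rewrite <- (u a I), <- (u b I). Qed.

Lemma terminal_hom_eq {C : Category} {Z X : C} (h : is_terminal Z) (a b : Hom X Z) :
  a = b.
Proof. destruct (h X) as [c [_ u]]; now rewrite <- (u a I), <- (u b I). Qed.

Lemma zero_morphism_eq {C : Category} {A B : C} (f g : Hom A B) :
  is_zero_morphism f -> is_zero_morphism g -> f = g.
Proof.
intros (Z & a & b & [hi ht] & ->) (Z' & a' & b' & [hi' ht'] & ->).
destruct (hi Z') as [c _].
rewrite (initial_hom_eq hi b (b' ∘ c)), (terminal_hom_eq ht' a' (c ∘ a)).
symmetry; apply comp_assoc.
Qed.

Lemma zero_morphism_comp_l {C : Category} {A B D : C} (g : Hom B D) (f : Hom A B) :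
  is_zero_morphism f -> is_zero_morphism (g ∘ f).
Proof.
intros (Z & a & b & hZ & ->); exists Z, a, (g ∘ b); split; trivial.
apply comp_assoc.
Qed.

Lemma zero_morphism_comp_r {C : Category} {A B D : C} (g : Hom B D) (f : Hom A B) :
  is_zero_morphism g -> is_zero_morphism (g ∘ f).
Proof.
intros (Z & a & b & hZ & ->); exists Z, (a ∘ f), b; split; trivial.
symmetry; apply comp_assoc.
Qed.

Lemma kernel_mono {C : Category} {K A B : C} {f : Hom A B} {k : Hom K A} :
  is_kernel f k -> is_mono k.
Proof.
intros [hz hu] X a b e.
destruct (hu X (k ∘ a)) as [c [_ u]].
- rewrite comp_assoc; now apply zero_morphism_comp_r.
- now rewrite <- (u a eq_refl), <- (u b (eq_sym e)).
Qed.

Lemma iso_mono {C : Category} {A B : C} {f : Hom A B} : is_iso f -> is_mono f.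
Proof.
intros [g [e _]] X a b eab.
now rewrite <- (comp_idl a), <- (comp_idl b), <- e, <- !comp_assoc, eab.
Qed.

Lemma point_iso_iff {C : Category} {B : C} {X Y : point B} (w : point_hom X Y) :
  @is_iso (Pt B) X Y w <-> is_iso (pt_map w).
Proof.
split.
- intros [g [e1 e2]]; exists (pt_map g); split.
  + exact (f_equal pt_map e1).
  + exact (f_equal pt_map e2).
- intros [g [e1 e2]].
  unshelve eexists {| pt_map := g |}.
  + now rewrite <- (pt_map_proj w), <- comp_assoc, e2, comp_idr.
  + now rewrite <- (pt_map_sect w), comp_assoc, e1, comp_idl.
  + split; now apply point_hom_eq.
Qed.

(** * Pullbacks and the limits built from them *)

Lemma pullback_exists {C : Category} (hl : has_finite_limits C) {A B D : C}
    (f : Hom A D) (g : Hom B D) :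
  exists (P : C) (p1 : Hom P A) (p2 : Hom P B), is_pullback f g p1 p2.
Proof.
destruct (finite_limits_pullback_choice C hl) as [P].
exact (ex_intro _ _ (ex_intro _ _ (ex_intro _ _ (pb_spec (P _ _ _ f g))))).
Qed.

Lemma pullback_lift {C : Category} {P A B D : C} {f : Hom A D} {g : Hom B D}
    {p1 : Hom P A} {p2 : Hom P B} (h : is_pullback f g p1 p2)
    {X : C} (a : Hom X A) (b : Hom X B) :
  f ∘ a = g ∘ b -> exists l : Hom X P, p1 ∘ l = a /\ p2 ∘ l = b.
Proof. intros e; destruct (proj2 h X a b e) as [l [hl _]]; now exists l. Qed.

Lemma pullback_hom_eq {C : Category} {P A B D : C} {f : Hom A D} {g : Hom B D}
    {p1 : Hom P A} {p2 : Hom P B} (h : is_pullback f g p1 p2)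
    {X : C} (l l' : Hom X P) :
  p1 ∘ l = p1 ∘ l' -> p2 ∘ l = p2 ∘ l' -> l = l'.
Proof. exact (pb_hom_eq (Build_pullback C A B D f g P p1 p2 h) l l'). Qed.

Lemma pullback_mono {C : Category} {P A B D : C} {f : Hom A D} {g : Hom B D}
    {p1 : Hom P A} {p2 : Hom P B} :
  is_pullback f g p1 p2 -> is_mono f -> is_mono p2.
Proof.
intros h hf X a b e; apply (pullback_hom_eq h); trivial.
apply hf; rewrite !comp_assoc, (proj1 h), <- !comp_assoc; now f_equal.
Qed.

Lemma kernel_iff_pullback {C : Category} {K A B Z : C} (hZ : is_zero_object Z)
    (f : Hom A B) (k : Hom K A) (z : Hom Z B) (c : Hom K Z) :
  is_kernel f k <-> is_pullback f z k c.
Proof.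
assert (hzero : forall X (a : Hom X A) (b : Hom X Z),
           is_zero_morphism (f ∘ a) <-> f ∘ a = z ∘ b).
{ intros X a b; split.
  - intros h; apply zero_morphism_eq; trivial; now exists Z, b, z.
  - intros e; now exists Z, b, z. }
split; intros [e u]; split.
- now apply hzero.
- intros X a b eab; destruct (u X a (proj2 (hzero X a b) eab)) as [l [el ul]].
  exists l; split; [ split; trivial; apply (terminal_hom_eq (proj2 hZ)) | ].
  intros l' [e1 _]; now apply ul.
- now apply (hzero K k c).
- intros X t ht; destruct (proj2 hZ X) as [b _].
  destruct (u X t b (proj1 (hzero X t b) ht)) as [l [[el _] ul]].
  exists l; split; trivial.
  intros l' e1; apply ul; split; trivial; apply (terminal_hom_eq (proj2 hZ)).
Qed.

Lemma kernel_exists {C : Category} (hp : pointed C) (hl : has_finite_limits C)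
    {A B : C} (f : Hom A B) :
  exists (K : C) (k : Hom K A), is_kernel f k.
Proof.
destruct hp as [Z hZ]; destruct (proj1 hZ B) as [z _].
destruct (pullback_exists hl f z) as (K & k & c & h).
exists K, k; now apply (kernel_iff_pullback hZ f k z c).
Qed.

Lemma equalizer_exists {C : Category} (hp : pointed C) (hl : has_finite_limits C)
    {A B : C} (a b : Hom A B) :
  exists (M : C) (m : Hom M A), is_mono m /\ a ∘ m = b ∘ m /\
    forall (X : C) (t : Hom X A), a ∘ t = b ∘ t -> exists h : Hom X M, m ∘ h = t.
Proof.
destruct hp as [Z [_ ht]].
destruct (ht A) as [za _], (ht B) as [zb _].
(* [W] is the product of [A] and [B]; the equalizer is the intersection of the
   graphs of [a] and [b]. *)
destruct (pullback_exists hl za zb) as (W & w1 & w2 & hW).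
destruct (pullback_lift hW (idm A) a (terminal_hom_eq ht _ _)) as (ga & ga1 & ga2).
destruct (pullback_lift hW (idm A) b (terminal_hom_eq ht _ _)) as (gb & gb1 & gb2).
destruct (pullback_exists hl ga gb) as (M & m & m' & hM).
assert (em : m = m').
{ rewrite <- (comp_idl m), <- ga1, <- comp_assoc, (proj1 hM), comp_assoc, gb1.
  apply comp_idl. }
subst m'; exists M, m; split; [ | split ].
- intros X x y e; now apply (pullback_hom_eq hM).
- now rewrite <- ga2, <- gb2, <- !comp_assoc, (proj1 hM).
- intros X t e; destruct (pullback_lift hM t t) as (h & h1 & _); [ | now exists h ].
  apply (pullback_hom_eq hW); rewrite !comp_assoc.
  + now rewrite ga1, gb1.
  + now rewrite ga2, gb2.
Qed.

(** * Regular and extremal epimorphisms *)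

Lemma regular_epi_cancel {C : Category} {A B : C} {q : Hom A B} :
  regular_epi C A B q ->
  forall (Y : C) (s t : Hom B Y), s ∘ q = t ∘ q -> s = t.
Proof.
intros (X & a & b & e & u) Y s t est.
destruct (u Y (s ∘ q)) as [h [_ uh]].
- now rewrite <- !comp_assoc, e.
- now rewrite <- (uh s eq_refl), <- (uh t (eq_sym est)).
Qed.

Lemma iso_regular_epi {C : Category} {A B : C} (f : Hom A B) :
  is_iso f -> regular_epi C A B f.
Proof.
intros [g [e1 e2]]; exists A, (idm A), (idm A); split; trivial.
intros Y t _; exists (t ∘ g); split.
- now rewrite <- comp_assoc, e1, comp_idr.
- intros h <-; now rewrite <- comp_assoc, e2, comp_idr.
Qed.

Lemma split_epi_regular {C : Category} {A B : C} (p : Hom A B) (s : Hom B A) :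
  p ∘ s = idm B -> regular_epi C A B p.
Proof.
intros e; exists A, (s ∘ p), (idm A); split.
- now rewrite comp_assoc, e, comp_idl, comp_idr.
- intros Y t et; exists (t ∘ s); split.
  + now rewrite <- comp_assoc, et, comp_idr.
  + intros h <-; now rewrite <- comp_assoc, e, comp_idr.
Qed.

Lemma regular_epi_coequalizes_kernel_pair {C : Category} {R A B : C} {f : Hom A B}
    {r1 r2 : Hom R A} :
  regular_epi C A B f -> is_kernel_pair f r1 r2 -> is_coequalizer r1 r2 f.
Proof.
intros (X & a & b & e & u) hR; split; [ exact (proj1 hR) | ].
intros Y t et; apply u.
destruct (pullback_lift hR a b e) as (l & <- & <-).
now rewrite !comp_assoc, et.
Qed.

Definition extremal_epi {C : Category} {A B : C} (f : Hom A B) : Prop :=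
  forall (M : C) (m : Hom M B) (h : Hom A M), is_mono m -> f = m ∘ h -> is_iso m.

Lemma regular_epi_extremal {C : Category} {A B : C} {f : Hom A B} :
  regular_epi C A B f -> extremal_epi f.
Proof.
intros hf M m h hm e.
pose proof hf as (X & a & b & eab & u).
destruct (u M h) as [d [ed _]].
{ apply hm; now rewrite !comp_assoc, <- e. }
assert (md : m ∘ d = idm B).
{ apply (regular_epi_cancel hf); now rewrite comp_idl, <- comp_assoc, ed. }
exists d; split; trivial.
apply hm; now rewrite comp_assoc, md, comp_idl, comp_idr.
Qed.

Lemma extremal_epi_comp {C : Category} (hl : has_finite_limits C) {A B D : C}
    (g : Hom B D) (f : Hom A B) :
  extremal_epi f -> extremal_epi g -> extremal_epi (g ∘ f).
Proof.
intros hf hg M m h hm e.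
(* [f] factors through the inverse image of [m] under [g], which is therefore
   everything: so [g] itself factors through [m]. *)
destruct (pullback_exists hl m g) as (P & p1 & p2 & hP).
destruct (pullback_lift hP h f (eq_sym e)) as (l & _ & el).
destruct (hf P p2 l (pullback_mono hP hm) (eq_sym el)) as [i [_ ei]].
apply (hg M m (p1 ∘ i) hm).
now rewrite comp_assoc, (proj1 hP), <- comp_assoc, ei, comp_idr.
Qed.

Lemma extremal_epi_of_comp {C : Category} {A B D : C} (g : Hom B D) (f : Hom A B) :
  extremal_epi (g ∘ f) -> extremal_epi g.
Proof.
intros h M m l hm e; apply (h M m (l ∘ f) hm); now rewrite e, comp_assoc.
Qed.

(** The image of [f] is the coequalizer of its kernel pair; the induced
    comparison is monic because two generalized elements of the image can be
    lifted to [A] over a common cover, which stays epic by pullback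
    stability. *)
Lemma regular_image {C : Category} (hr : regular C) {A B : C} (f : Hom A B) :
  exists (I : C) (q : Hom A I) (m : Hom I B),
    regular_epi C A I q /\ is_mono m /\ f = m ∘ q.
Proof.
destruct hr as (hl & hc & hs).
destruct (pullback_exists hl f f) as (R & r1 & r2 & hR).
destruct (hc _ _ _ f r1 r2 hR) as (Q & q & hq).
assert (rq : regular_epi C A Q q) by now exists R, r1, r2.
destruct (proj2 hq B f (proj1 hR)) as [m [em _]].
exists Q, q, m; split; [ | split ]; trivial; [ | now symmetry ].
intros X x y exy.
destruct (pullback_exists hl q x) as (X1 & a1 & e1 & h1).
destruct (pullback_exists hl q (y ∘ e1)) as (X2 & a2 & e2 & h2).
apply (regular_epi_cancel (hs _ _ _ _ _ _ _ _ h1 rq)).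
apply (regular_epi_cancel (hs _ _ _ _ _ _ _ _ h2 rq)).
rewrite <- (proj1 h1), <- (proj1 h2), <- comp_assoc.
destruct (pullback_lift hR (a1 ∘ e2) a2) as (l & l1 & l2).
- rewrite <- em, <- !comp_assoc, (proj1 h2), (comp_assoc q), (proj1 h1).
  now rewrite !comp_assoc, exy.
- now rewrite <- l1, <- l2, !comp_assoc, (proj1 hq).
Qed.

(** An extremal epimorphism forces the monic part of its image factorization to
    be an isomorphism, hence coincides with the regular part. *)
Lemma regular_epi_iff_extremal {C : Category} (hr : regular C) {A B : C}
    (f : Hom A B) :
  regular_epi C A B f <-> extremal_epi f.
Proof.
split; [ apply regular_epi_extremal | ].
intros hf; destruct (regular_image hr f) as (I & q & m & hq & hm & e).
destruct (hf I m q hm e) as [n [nm mn]].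
destruct hq as (X & a & b & eab & u); exists X, a, b; split.
- now rewrite e, <- !comp_assoc, eab.
- intros Y t et; destruct (u Y t et) as [h [eh uh]].
  exists (h ∘ n); split.
  + now rewrite e, comp_assoc, <- (comp_assoc h), nm, comp_idr.
  + intros h' e'; rewrite (uh (h' ∘ m)).
    * now rewrite <- comp_assoc, mn, comp_idr.
    * now rewrite <- e', e, comp_assoc.
Qed.

Lemma regular_epi_comp {C : Category} (hr : regular C) {A B D : C}
    (g : Hom B D) (f : Hom A B) :
  regular_epi C A B f -> regular_epi C B D g -> regular_epi C A D (g ∘ f).
Proof.
rewrite !(regular_epi_iff_extremal hr); apply extremal_epi_comp, hr.
Qed.

Lemma regular_epi_of_comp {C : Category} (hr : regular C) {A B D : C}
    (g : Hom B D) (f : Hom A B) :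
  regular_epi C A D (g ∘ f) -> regular_epi C B D g.
Proof. rewrite !(regular_epi_iff_extremal hr); apply extremal_epi_of_comp. Qed.

(** * The short five lemma implies protomodularity *)

Lemma short_five_protomodular {C : Category} (hp : pointed C)
    (hl : has_finite_limits C) :
  short_five (regular_epi C) -> protomodular C.
Proof.
intros h5; split; trivial.
intros P B B' v X Y w hw.
change (@is_iso (Pt B') _ _ (pullback_point_map P v w)) in hw.
apply point_iso_iff in hw; apply point_iso_iff.
simpl in hw.
set (Q := P _ _ _ (pt_proj X) v) in *; set (Q' := P _ _ _ (pt_proj Y) v) in *.
set (vw := pb_lift Q' _ _ _) in hw.
assert (vw1 : pb_fst Q' ∘ vw = pt_map w ∘ pb_fst Q) by apply pb_lift_fst.
assert (vw2 : pb_snd Q' ∘ vw = pb_snd Q) by apply pb_lift_snd.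
clearbody vw.
assert (pw : forall T (x : Hom T (pt_obj X)),
           pt_proj X ∘ x = pt_proj Y ∘ (pt_map w ∘ x))
  by (intros T x; now rewrite comp_assoc, pt_map_proj).
destruct (kernel_exists hp hl (pt_proj X)) as (K & k & hk).
apply (h5 K (pt_obj X) (pt_obj Y) B (pt_proj X) (pt_proj Y) k (pt_map w ∘ k));
  trivial.
- exact (split_epi_regular _ _ (pt_split X)).
- exact (split_epi_regular _ _ (pt_split Y)).
- split.
  { rewrite comp_assoc, pt_map_proj; exact (proj1 hk). }
  intros T t ht.
  (* An element killed by the projection lifts to the pullback along [v] by
     taking zero as its second component. *)
  destruct (zero_morphism_exists hp T B') as [z hz].
  assert (ez : pt_proj Y ∘ t = v ∘ z)
    by (apply zero_morphism_eq; trivial; now apply zero_morphism_comp_l).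
  pose proof hw as (vi & _ & wvi).
  set (t' := vi ∘ pb_lift Q' t z ez).
  assert (et' : vw ∘ t' = pb_lift Q' t z ez)
    by (unfold t'; now rewrite comp_assoc, wvi, comp_idl).
  assert (e1 : pt_map w ∘ (pb_fst Q ∘ t') = t)
    by (rewrite comp_assoc, <- vw1, <- comp_assoc, et'; apply pb_lift_fst).
  destruct (proj2 hk T (pb_fst Q ∘ t')) as [h [eh _]].
  { now rewrite pw, e1. }
  exists h; split.
  { rewrite <- comp_assoc, eh; exact e1. }
  intros h' eh'; apply (kernel_mono hk).
  assert (ek : pt_proj X ∘ (k ∘ h') = v ∘ z).
  { now rewrite <- ez, <- eh', pw, (comp_assoc (pt_map w)). }
  rewrite eh, <- (pb_lift_fst Q (k ∘ h') z ek); f_equal.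
  apply (iso_mono hw); rewrite et'; apply pb_hom_eq.
  + now rewrite pb_lift_fst, comp_assoc, vw1, <- comp_assoc, pb_lift_fst, comp_assoc.
  + now rewrite pb_lift_snd, comp_assoc, vw2, pb_lift_snd.
- apply pt_map_proj.
Qed.

(** * Points in pointed protomodular categories *)

(** Protomodularity freed from the choice of pullbacks: the second hypothesis
    says that [v^*] sends [w] to an isomorphism. *)
Lemma protomodular_reflects {C : Category} (hm : protomodular C) {B B' T : C}
    {X Y : point B} (w : point_hom X Y) (v : Hom B' B)
    (p1 : Hom T (pt_obj X)) (p2 : Hom T B') :
  is_pullback (pt_proj X) v p1 p2 ->
  is_pullback (pt_proj Y) v (pt_map w ∘ p1) p2 -> is_iso (pt_map w).
Proof.
intros hX hY; destruct hm as [hl hm].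
destruct (finite_limits_pullback_choice C hl) as [P].
apply point_iso_iff, (hm P B B' v).
change (@is_iso (Pt B') _ _ (pullback_point_map P v w)).
apply point_iso_iff; simpl.
set (Q := P _ _ _ (pt_proj X) v); set (Q' := P _ _ _ (pt_proj Y) v).
set (vw := pb_lift Q' _ _ _).
assert (vw1 : pb_fst Q' ∘ vw = pt_map w ∘ pb_fst Q) by apply pb_lift_fst.
assert (vw2 : pb_snd Q' ∘ vw = pb_snd Q) by apply pb_lift_snd.
clearbody vw.
destruct (pullback_lift hY _ _ (proj1 (pb_spec Q'))) as (l & l1 & l2).
set (i := pb_lift Q p1 p2 (proj1 hX)).
assert (i1 : pb_fst Q ∘ i = p1) by apply pb_lift_fst.
assert (i2 : pb_snd Q ∘ i = p2) by apply pb_lift_snd.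
clearbody i.
assert (e : vw ∘ (i ∘ l) = idm (pb_obj Q')).
{ apply pb_hom_eq; rewrite comp_idr, comp_assoc.
  - now rewrite vw1, <- comp_assoc, (comp_assoc (pb_fst Q)), i1, comp_assoc.
  - now rewrite vw2, comp_assoc, i2. }
exists (i ∘ l); split; trivial.
assert (hv : is_mono vw).
{ destruct (pullback_lift hX _ _ (proj1 (pb_spec Q))) as (j & j1 & j2).
  intros U a b eab.
  assert (eT : j ∘ a = j ∘ b).
  { apply (pullback_hom_eq hY); rewrite <- ?comp_assoc, ?(comp_assoc p1),
      ?(comp_assoc p2), ?j1, ?j2.
    - now rewrite !comp_assoc, <- vw1, <- !comp_assoc, eab.
    - now rewrite <- vw2, <- !comp_assoc, eab. }
  apply pb_hom_eq.
  - now rewrite <- j1, <- !comp_assoc, eT.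
  - now rewrite <- j2, <- !comp_assoc, eT. }
apply hv; now rewrite comp_assoc, e, comp_idl, comp_idr.
Qed.

(** The kernel of the projection is the pullback along the morphism out of the
    zero object. *)
Lemma point_hom_iso_of_kernel {C : Category} (hp : pointed C) (hm : protomodular C)
    {B K : C} {X Y : point B} (w : point_hom X Y) (k : Hom K (pt_obj X)) :
  is_kernel (pt_proj X) k -> is_kernel (pt_proj Y) (pt_map w ∘ k) ->
  is_iso (pt_map w).
Proof.
intros hX hY; destruct hp as [Z hZ].
destruct (proj1 hZ B) as [z _], (proj2 hZ K) as [c _].
apply (protomodular_reflects hm w z k c); now apply (kernel_iff_pullback hZ).
Qed.

(** The kernel and the section of a point are jointly extremal: a subobject
    containing both is itself a point with the same kernel. *)
Lemma kernel_section_extremal {C : Category} (hp : pointed C) (hm : protomodular C)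
    {B K M : C} (X : point B) (k : Hom K (pt_obj X)) (m : Hom M (pt_obj X))
    (a : Hom K M) (b : Hom B M) :
  is_kernel (pt_proj X) k -> is_mono m -> m ∘ a = k -> m ∘ b = pt_sect X ->
  is_iso m.
Proof.
intros hk mono_m ea eb.
assert (split_M : (pt_proj X ∘ m) ∘ b = idm B)
  by (rewrite <- comp_assoc, eb; apply pt_split).
set (Y := {| pt_obj := M; pt_proj := pt_proj X ∘ m; pt_sect := b;
             pt_split := split_M |}).
set (w := Build_point_hom C B Y X m eq_refl eb).
apply (point_hom_iso_of_kernel hp hm w a); simpl; [ | now rewrite ea ].
split.
- rewrite <- comp_assoc, ea; exact (proj1 hk).
- intros T t ht; destruct (proj2 hk T (m ∘ t)) as [h [eh uh]].
  { now rewrite comp_assoc. }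
  exists h; split.
  + apply mono_m; now rewrite comp_assoc, ea.
  + intros h' <-; apply uh; now rewrite comp_assoc, ea.
Qed.

(** [r1] projects [A xB A'] to [A], and its kernel consists of the pairs whose
    first component is zero, that is, of the kernel of [f']. *)
Lemma pullback_proj_kernel {C : Category} {R A A' B K : C}
    {f : Hom A B} {f' : Hom A' B} {r1 : Hom R A} {r2 : Hom R A'} {k : Hom K A'}
    {j : Hom K R} :
  is_pullback f f' r1 r2 -> is_kernel f' k ->
  is_zero_morphism (r1 ∘ j) -> r2 ∘ j = k -> is_kernel r1 j.
Proof.
intros hR hk hj ej; split; trivial.
intros T t ht; destruct (proj2 hk T (r2 ∘ t)) as [h [eh uh]].
{ rewrite comp_assoc, <- (proj1 hR), <- comp_assoc; now apply zero_morphism_comp_l. }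
exists h; split.
- apply (pullback_hom_eq hR).
  + apply zero_morphism_eq; trivial; rewrite comp_assoc; now apply zero_morphism_comp_r.
  + now rewrite comp_assoc, ej.
- intros h' <-; apply uh; now rewrite comp_assoc, ej.
Qed.

(** * Regular epimorphisms in homological categories *)

(** A morphism [t] killing the kernel of [f] equalizes the kernel pair: the
    equalizer of [t r1] and [t r2] contains the diagonal and the elements
    [(0, k)], which generate the point [(R, r1, d)]. *)
Lemma regular_epi_normal {C : Category} (hh : homological C) {A B : C}
    (f : Hom A B) :
  regular_epi C A B f -> normal_epi A B f.
Proof.
intros hf; destruct hh as (hp & (hl & _ & _) & hm).
destruct (kernel_exists hp hl f) as (K & k & hk).
destruct (pullback_exists hl f f) as (R & r1 & r2 & hR).
exists K, k; split; [ exact (proj1 hk) | ].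
intros Y t ht.
apply (proj2 (regular_epi_coequalizes_kernel_pair hf hR)).
destruct (pullback_lift hR (idm A) (idm A) eq_refl) as (d & d1 & d2).
destruct (zero_morphism_exists hp K A) as [z hz].
(* [j] is the pair [(0, k)], the kernel of [r1]. *)
destruct (pullback_lift hR z k) as (j & j1 & j2).
{ apply zero_morphism_eq; [ now apply zero_morphism_comp_l | exact (proj1 hk) ]. }
set (X := {| pt_obj := R; pt_proj := r1; pt_sect := d; pt_split := d1 |}).
destruct (equalizer_exists hp hl (t ∘ r1) (t ∘ r2)) as (M & m & mono_m & em & um).
destruct (um A d) as [b eb].
{ now rewrite <- !comp_assoc, d1, d2. }
destruct (um K j) as [a ea].
{ rewrite <- !comp_assoc, j1, j2.
  apply zero_morphism_eq; trivial; now apply zero_morphism_comp_l. }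
assert (iso_m : is_iso m).
{ apply (kernel_section_extremal hp hm X j m a b); trivial.
  apply (pullback_proj_kernel hR hk); trivial; simpl; now rewrite j1. }
destruct iso_m as [n [_ mn]].
now rewrite <- (comp_idr (t ∘ r1)), <- mn, comp_assoc, em, <- comp_assoc, mn,
  comp_idr.
Qed.

(** The pullback [g : A xB A -> A xB A'] of [w] along [f] is a morphism of
    points over [A], the two projections to [A] being split by the diagonal and
    by the graph of [w].  It is an isomorphism by protomodularity.  That [w] is
    monic is then read off from [g (x, x) = g (x, y)], and that [w] is a regular
    epimorphism from the fact that [A xB A' -> A'], a pullback of [f], factors
    through [w]. *)
Lemma homological_short_five {C : Category} (hh : homological C) :
  short_five (regular_epi C).
Proof.
intros K A A' B f f' k k' w hf _ hk hk' ek ew.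
destruct hh as (hp & hr & hm).
pose proof hr as (hl & _ & hs).
destruct (pullback_exists hl f f) as (R & r1 & r2 & hR).
destruct (pullback_exists hl f f') as (S & s1 & s2 & hS).
destruct (pullback_lift hR (idm A) (idm A) eq_refl) as (d & d1 & d2).
destruct (pullback_lift hS (idm A) w) as (c & c1 & c2).
{ now rewrite comp_idr, ew. }
destruct (pullback_lift hS r1 (w ∘ r2)) as (g & g1 & g2).
{ now rewrite comp_assoc, ew, (proj1 hR). }
assert (gd : g ∘ d = c).
{ apply (pullback_hom_eq hS); rewrite comp_assoc.
  - now rewrite g1, d1, c1.
  - now rewrite g2, <- comp_assoc, d2, comp_idr, c2. }
set (X := {| pt_obj := R; pt_proj := r1; pt_sect := d; pt_split := d1 |}).
set (Y := {| pt_obj := S; pt_proj := s1; pt_sect := c; pt_split := c1 |}).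
set (wg := Build_point_hom C A X Y g g1 gd).
destruct (zero_morphism_exists hp K A) as [z hz].
(* [j] is the pair [(0, k)], the kernel of [r1]. *)
destruct (pullback_lift hR z k) as (j & j1 & j2).
{ apply zero_morphism_eq; [ now apply zero_morphism_comp_l | exact (proj1 hk) ]. }
assert (hg : is_iso g).
{ apply (point_hom_iso_of_kernel hp hm wg j); simpl.
  - apply (pullback_proj_kernel hR hk); trivial; now rewrite j1.
  - apply (pullback_proj_kernel hS hk'); rewrite comp_assoc.
    + now rewrite g1, j1.
    + now rewrite g2, <- comp_assoc, j2. }
assert (mono_w : is_mono w).
{ intros T x y exy.
  assert (fxy : f ∘ x = f ∘ y) by now rewrite <- ew, <- !comp_assoc, exy.
  destruct (pullback_lift hR x x eq_refl) as (xx & xx1 & xx2).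
  destruct (pullback_lift hR x y fxy) as (xy & xy1 & xy2).
  rewrite <- xx2, <- xy2; f_equal.
  apply (iso_mono hg), (pullback_hom_eq hS); rewrite !comp_assoc.
  - now rewrite g1, xx1, xy1.
  - now rewrite g2, <- !comp_assoc, xx2, xy2. }
assert (epi_w : regular_epi C A A' w).
{ destruct hg as [i [_ gi]].
  apply (regular_epi_of_comp hr w (r2 ∘ i)).
  rewrite comp_assoc, <- g2, <- comp_assoc, gi, comp_idr.
  exact (hs _ _ _ _ _ _ _ _ hS hf). }
exact (regular_epi_extremal epi_w A w (idm A) mono_w (eq_sym (comp_idr w))).
Qed.

(** Let [w] factor through a subobject [m] of [A'].  Since [u] is extremal, [m]
    contains the kernel of [f'], so that [m] and the identity of [A'] are
    compared by the short five lemma over [B]. *)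
Lemma homological_kernel_in_class {C : Category} (hh : homological C)
    {K K' A A' B : C} (f : Hom A B) (f' : Hom A' B) (k : Hom K A) (k' : Hom K' A')
    (u : Hom K K') (w : Hom A A') :
  regular_epi C A B f -> regular_epi C A' B f' -> is_kernel f' k' ->
  w ∘ k = k' ∘ u -> f' ∘ w = f -> regular_epi C K K' u -> regular_epi C A A' w.
Proof.
intros hf hf' hk' ek ew hu.
pose proof hh as (hp & hr & hm).
pose proof hr as (hl & _ & _).
apply (regular_epi_iff_extremal hr); intros M m h mono_m e.
destruct (pullback_exists hl m k') as (P & p & j & hP).
destruct (pullback_lift hP (h ∘ k) u) as (l & _ & el).
{ now rewrite comp_assoc, <- e. }
destruct (regular_epi_extremal hu P j l (pullback_mono hP mono_m) (eq_sym el))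
  as [i [_ ji]].
assert (en : m ∘ (p ∘ i) = k')
  by now rewrite comp_assoc, (proj1 hP), <- comp_assoc, ji, comp_idr.
apply (homological_short_five hh K' M A' B (f' ∘ m) f' (p ∘ i) k'); trivial.
- apply (regular_epi_of_comp hr _ h); now rewrite <- comp_assoc, <- e, ew.
- split.
  + rewrite <- comp_assoc, en; exact (proj1 hk').
  + intros T t ht; destruct (proj2 hk' T (m ∘ t)) as [s [es us]].
    { now rewrite comp_assoc. }
    exists s; split.
    * apply mono_m; now rewrite comp_assoc, en.
    * intros s' <-; apply us; now rewrite comp_assoc, en.
Qed.

(** * The equivalence *)

Lemma weakly_homological_is_homological {C : Category}
    (hcoeq : has_coequalizers_of_kernel_pairs C) :
  relative_weakly_homological C (regular_epi C) -> homological C.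
Proof.
intros [hp hl _ _ hs _ h5 _ _]; split; [ | split ]; trivial.
- now split.
- now apply short_five_protomodular.
Qed.

Lemma homological_is_relative {C : Category} (hcoker : has_cokernels C) :
  homological C -> relative_homological C (regular_epi C).
Proof.
intros hh; pose proof hh as (hp & hr & hm); pose proof hr as (hl & hc & hs).
split; [ split | | ]; trivial.
- exact (@iso_regular_epi C).
- intros A B f; now apply regular_epi_normal.
- now apply homological_short_five.
- intros A B D g f; now apply regular_epi_comp.
- intros A B D g f _; now apply regular_epi_of_comp.
- intros A I B f m e _ _ _; exact (regular_image hr f).
- intros K K' A A' B f f' k k' u w hf hf' _ hk' ek ew hu.
  exact (homological_kernel_in_class hh f f' k k' u w hf hf' hk' ek ew hu).
Qed.

Theorem proposition3p2 (C : Category)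
    (hpointed : pointed C)
    (hlim : has_finite_limits C)
    (hcoker : has_cokernels C)
    (hcoeq : has_coequalizers_of_kernel_pairs C) :
  (relative_weakly_homological C (regular_epi C)
     <-> relative_homological C (regular_epi C)) /\
  (relative_homological C (regular_epi C) <-> homological C).
Proof.
split; split.
- intros h; apply homological_is_relative; trivial.
  now apply weakly_homological_is_homological.
- apply rh_weakly.
- intros h; now apply weakly_homological_is_homological, rh_weakly.
- now apply homological_is_relative.
Qed.
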